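(* Let $(\mathfrak{g},\{\cdot,\cdot,\cdot\},\mu,\epsilon,\alpha,\beta)$ be a noncommutative $3$-BiHom-Poisson color algebra that is multiplicative and regular, and let $\mathcal{R}:\mathfrak{g}\to\mathfrak{g}$ be a Rota-Baxter operator of weight zero on $\mathfrak{g}$. Define, for $x,y,z\in\mathcal{H}(\mathfrak{g})$, $$\{x,y,z\}_{\mathcal{R}}=\{\mathcal{R}(x),\mathcal{R}(y),z\},\qquad x\prec_{\mathcal{R}}y=\mu(x,\mathcal{R}(y)),\qquad x\succ_{\mathcal{R}}y=\mu(\mathcal{R}(x),y).$$ Then $(\mathfrak{g},\{\cdot,\cdot,\cdot\}_{\mathcal{R}},\prec_{\mathcal{R}},\succ_{\mathcal{R}},\epsilon,\alpha,\beta)$ is a noncommutative $3$-BiHom-pre-Poisson color algebra.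
   Context: $\mathbb{K}$ is an algebraically closed field of characteristic zero and $\Gamma$ is an abelian group. For a $\Gamma$-graded vector space $V=\bigoplus_{a\in\Gamma}V_a$, $\mathcal{H}(V)$ is the set of homogeneous elements. A linear or multilinear map between graded spaces is even if it has degree zero. A skew-symmetric bicharacter is a map $\epsilon:\Gamma\times\Gamma\to\mathbb{K}^*$ with $\epsilon(a,a')\epsilon(a',a)=1$, $\epsilon(a,a'+a'')=\epsilon(a,a')\epsilon(a,a'')$, $\epsilon(a+a',a'')=\epsilon(a,a'')\epsilon(a',a'')$. For homogeneous $x,y,z$ of degrees $a,b,c$ write $\epsilon(x,y)=\epsilon(a,b)$, $\epsilon(x+y,z)=\epsilon(a+b,c)$, etc. All identities below are for homogeneous elements. BiHom-associative color algebra $(\mathfrak{g},\mu,\epsilon,\alpha,\beta)$: a $\Gamma$-graded space with an even bilinear $\mu$ and even commuting linear maps $\alpha,\beta$ such that $\alpha(\mu(x,y))=\mu(\alpha(x),\alpha(y))$, $\beta(\mu(x,y))=\mu(\beta(x),\beta(y))$, $\mu(\alpha(x),\mu(y,z))=\mu(\mu(x,y),\beta(z))$. $3$-BiHom-Lie color algebra $(\mathfrak{g},[\cdot,\cdot,\cdot],\epsilon,\alpha,\beta)$: a $\Gamma$-graded space with an even trilinear bracket and even linear maps $\alpha,\beta$ such that $[\beta(x),\beta(y),\alpha(z)]=-\epsilon(x,y)[\beta(y),\beta(x),\alpha(z)]$, $[\beta(x),\beta(y),\alpha(z)]=-\epsilon(y,z)[\beta(x),\beta(z),\alpha(y)]$,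 and $[\beta^2(x),\beta^2(y),[\beta(z),\beta(u),\alpha(v)]]=\epsilon(x+y+z,u+v)[\beta^2(u),\beta^2(v),[\beta(x),\beta(y),\alpha(z)]]-\epsilon(x+y,z+v)\epsilon(u,v)[\beta^2(z),\beta^2(v),[\beta(x),\beta(y),\alpha(u)]]+\epsilon(x+y,z+u)[\beta^2(z),\beta^2(u),[\beta(x),\beta(y),\alpha(v)]]$. It is multiplicative if $\alpha\beta=\beta\alpha$ and $\alpha,\beta$ preserve the bracket. Noncommutative $3$-BiHom-Poisson color algebra $(\mathfrak{g},\{\cdot,\cdot,\cdot\},\mu,\epsilon,\alpha,\beta)$: $(\mathfrak{g},\mu,\epsilon,\alpha,\beta)$ is a BiHom-associative color algebra, $(\mathfrak{g},\{\cdot,\cdot,\cdot\},\epsilon,\alpha,\beta)$ is a $3$-BiHom-Lie color algebra, and $\{\alpha\beta(x),\alpha\beta(y),\mu(z,t)\}=\mu(\{\beta(x),\beta(y),z\},\beta(t))+\epsilon(x+y,z)\mu(\beta(z),\{\alpha(x),\alpha(y),t\})$. It is multiplicative if its $3$-BiHom-Lie color algebra is, and regular if $\alpha,\beta$ are bijective. A Rota-Baxter operator of weight $0$ on it is an even linear map $\mathcal{R}:\mathfrak{g}\to\mathfrak{g}$ commuting with $\alpha$ and $\beta$ such that $\mu(\mathcal{R}(x),\mathcal{R}(y))=\mathcal{R}(\mu(\mathcal{R}(x),y)+\mu(x,\mathcal{R}(y)))$ and $\{\mathcal{R}(x),\mathcal{R}(y),\mathcal{R}(z)\}=\mathcal{R}(\{\mathcal{R}(x),\mathcal{R}(y),z\}+\{\mathcal{R}(x),y,\mathcal{R}(z)\}+\{x,\mathcal{R}(y),\mathcal{R}(z)\})$.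 $3$-BiHom-pre-Lie color algebra $(A,\{\cdot,\cdot,\cdot\},\epsilon,\alpha,\beta)$: a $\Gamma$-graded space $A$ with an even trilinear map and commuting bijective even linear maps $\alpha,\beta$ preserving $\{\cdot,\cdot,\cdot\}$ such that, with $[x,y,z]^C=\{x,y,z\}-\epsilon(y,z)\{x,\beta\alpha^{-1}(z),\alpha\beta^{-1}(y)\}+\epsilon(x,y+z)\{y,\beta\alpha^{-1}(z),\alpha\beta^{-1}(x)\}$: (a) $\{\beta(x),\beta(y),\alpha(z)\}=-\epsilon(x,y)\{\beta(y),\beta(x),\alpha(z)\}$; (b) $\{\alpha\beta(x_4),\alpha\beta(x_5),\{x_1,x_2,x_3\}\}=\{[\beta(x_4),\beta(x_5),x_1]^C,\beta(x_2),\beta(x_3)\}+\epsilon(x_4+x_5,x_1)\{\beta(x_1),[\beta(x_4),\beta(x_5),x_2]^C,\beta(x_3)\}+\epsilon(x_4+x_5,x_1+x_2)\{\beta(x_1),\beta(x_2),\{\alpha(x_4),\alpha(x_5),x_3\}\}$; (c) $\{[\beta(x_4),\beta(x_5),x_1]^C,\beta(x_2),\beta(x_3)\}=\epsilon(x_4,x_1+x_5)\{\alpha\beta(x_5),\beta(x_1),\{\alpha(x_4),x_2,x_3\}\}+\epsilon(x_4+x_5,x_1)\{\beta(x_1),\alpha\beta(x_4),\{\alpha(x_5),x_2,x_3\}\}+\{\alpha\beta(x_4),\alpha\beta(x_5),\{x_1,x_2,x_3\}\}$. BiHom-dendriform color algebra $(A,\prec,\succ,\epsilon,\alpha,\beta)$: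 a $\Gamma$-graded space with even bilinear $\prec,\succ$ and commuting even linear maps $\alpha,\beta$ preserving $\prec$ and $\succ$ such that, with $x\cdot y=x\prec y+x\succ y$: $(x\prec y)\prec\beta(z)=\alpha(x)\prec(y\cdot z)$, $(x\succ y)\prec\beta(z)=\alpha(x)\succ(y\prec z)$, $\alpha(x)\succ(y\succ z)=(x\cdot y)\succ\beta(z)$. Noncommutative $3$-BiHom-pre-Poisson color algebra $(A,\{\cdot,\cdot,\cdot\},\prec,\succ,\epsilon,\alpha,\beta)$: a $3$-BiHom-pre-Lie color algebra $(A,\{\cdot,\cdot,\cdot\},\epsilon,\alpha,\beta)$ and a BiHom-dendriform color algebra $(A,\prec,\succ,\epsilon,\alpha,\beta)$ such that (P1) $\{\alpha\beta^2(x),\alpha\beta^2(y),z\prec\alpha(t)\}-\{\beta^2(x),\beta^2(y),z\}\prec\alpha\beta(t)=\epsilon(x+y,z)\beta(z)\prec\big(\{\alpha\beta(x),\alpha\beta(y),\alpha(t)\}-\epsilon(y,t)\{\alpha\beta(x),\beta(t),\alpha^2(y)\}+\epsilon(x,y+t)\{\alpha\beta(y),\beta(t),\alpha^2(x)\}\big)$; (P2) $\{\alpha\beta(x),\alpha^2\beta(y),\alpha(z)\succ t\}-\epsilon(x+y,z)\alpha\beta(z)\succ\{\alpha(x),\alpha^2(y),t\}=\big(\{\beta(x),\alpha\beta(y),\alpha(z)\}-\epsilon(y,z)\{\beta(x),\beta(z),\alpha^2(y)\}+\epsilon(x,y+z)\{\alpha\beta(y),\beta(z),\alpha(x)\}\big)\succ\beta(t)$;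 (P3) $\{\alpha\beta(x),\beta(y\prec z),\alpha^2\beta(t)\}+\{\alpha\beta(x),\beta(y\succ z),\alpha^2\beta(t)\}=\epsilon(x,y)\alpha\beta(y)\succ\{\alpha(x),\beta(z),\alpha^2(t)\}+\epsilon(z,t)\{\beta(x),\beta(y),\alpha\beta(t)\}\prec\alpha\beta(z)$. *)

(* Defs.v *)
From HB Require Import structures.
From mathcomp Require Import all_boot all_order all_algebra.

Set Implicit Arguments.
Unset Strict Implicit.
Unset Printing Implicit Defensive.

Import GRing.Theory.
Local Open Scope ring_scope.

(* Conventions.  A graded space is an lmodType g over K together with an internal
   grading V : Gamma -> g -> Prop, where [V a x] means that x is homogeneous of
   degree a.  The zero vector has every degree; the identities below do not
   depend on the degree chosen for it.  A factor written epsilon(x + y, z) in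
   the literature is eps (a + b) c, for x, y, z of degrees a, b, c. *)

Section ColorAlgebras.

Context {K : closedFieldType} {Gamma : zmodType} {g : lmodType K}.

Implicit Types (V : Gamma -> g -> Prop) (eps : Gamma -> Gamma -> K).
Implicit Types (alpha beta R : {linear g -> g}).
Implicit Types (mu prec succ : g -> g -> g) (br : g -> g -> g -> g).

Record is_grading V : Prop := IsGrading {
  grading0 : forall a, V a 0;
  grading_linear : forall a (k : K) x y, V a x -> V a y -> V a (k *: x + y);
  grading_span : forall x, exists (s : seq Gamma) (f : Gamma -> g),
    [/\ uniq s, forall a, V a (f a) & x = \sum_(a <- s) f a];
  grading_direct : forall (s : seq Gamma) (f : Gamma -> g),
    uniq s -> (forall a, V a (f a)) -> \sum_(a <- s) f a = 0 ->
    forall a, a \in s -> f a = 0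
}.

Record is_bicharacter eps : Prop := IsBicharacter {
  bichar_neq0 : forall a b, eps a b != 0;
  bichar_skew : forall a b, eps a b * eps b a = 1;
  bicharDr : forall a b c, eps a (b + c) = eps a b * eps a c;
  bicharDl : forall a b c, eps (a + b) c = eps a c * eps b c
}.

Definition is_bilinear mu : Prop :=
  (forall x, linear (mu x)) /\ (forall y, linear (mu^~ y)).

Definition is_trilinear br : Prop :=
  [/\ forall x y, linear (fun z => br x y z),
      forall x z, linear (fun y => br x y z) &
      forall y z, linear (fun x => br x y z)].

Definition even1 V (f : g -> g) : Prop := forall a x, V a x -> V a (f x).

Definition even2 V mu : Prop :=
  forall a b x y, V a x -> V b y -> V (a + b) (mu x y).

Definition even3 V br : Prop :=
  forall a b c x y z, V a x -> V b y -> V c z -> V (a + b + c) (br x y z).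

Definition preserves2 V (f : g -> g) mu : Prop :=
  forall a b x y, V a x -> V b y -> f (mu x y) = mu (f x) (f y).

Definition preserves3 V (f : g -> g) br : Prop :=
  forall a b c x y z, V a x -> V b y -> V c z ->
  f (br x y z) = br (f x) (f y) (f z).

Definition commuting (f h : g -> g) : Prop := forall x, f (h x) = h (f x).

Record is_bihom_assoc V mu eps alpha beta : Prop := IsBiHomAssoc {
  ba_grading : is_grading V;
  ba_bichar : is_bicharacter eps;
  ba_bilinear : is_bilinear mu;
  ba_even : even2 V mu;
  ba_alpha_even : even1 V alpha;
  ba_beta_even : even1 V beta;
  ba_comm : commuting alpha beta;
  ba_alpha_mu : preserves2 V alpha mu;
  ba_beta_mu : preserves2 V beta mu;
  ba_assoc : forall a b c x y z, V a x -> V b y -> V c z ->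
    mu (alpha x) (mu y z) = mu (mu x y) (beta z)
}.

Record is_3bihom_lie V br eps alpha beta : Prop := Is3BiHomLie {
  bl_grading : is_grading V;
  bl_bichar : is_bicharacter eps;
  bl_trilinear : is_trilinear br;
  bl_even : even3 V br;
  bl_alpha_even : even1 V alpha;
  bl_beta_even : even1 V beta;
  bl_skew12 : forall a b c x y z, V a x -> V b y -> V c z ->
    br (beta x) (beta y) (alpha z) =
      - (eps a b *: br (beta y) (beta x) (alpha z));
  bl_skew23 : forall a b c x y z, V a x -> V b y -> V c z ->
    br (beta x) (beta y) (alpha z) =
      - (eps b c *: br (beta x) (beta z) (alpha y));
  bl_jacobi : forall a b c d e x y z u v,
    V a x -> V b y -> V c z -> V d u -> V e v ->
    br (beta (beta x)) (beta (beta y)) (br (beta z) (beta u) (alpha v)) =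
      eps (a + b + c) (d + e) *:
        br (beta (beta u)) (beta (beta v)) (br (beta x) (beta y) (alpha z))
      - (eps (a + b) (c + e) * eps d e) *:
        br (beta (beta z)) (beta (beta v)) (br (beta x) (beta y) (alpha u))
      + eps (a + b) (c + d) *:
        br (beta (beta z)) (beta (beta u)) (br (beta x) (beta y) (alpha v))
}.

Record is_multiplicative V br alpha beta : Prop := IsMultiplicative {
  mult_comm : commuting alpha beta;
  mult_alpha : preserves3 V alpha br;
  mult_beta : preserves3 V beta br
}.

Record is_nc_3bihom_poisson V br mu eps alpha beta : Prop := IsNC3BiHomPoisson {
  bp_assoc : is_bihom_assoc V mu eps alpha beta;
  bp_lie : is_3bihom_lie V br eps alpha beta;
  bp_leibniz : forall a b c d x y z t,
    V a x -> V b y -> V c z -> V d t ->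
    br (alpha (beta x)) (alpha (beta y)) (mu z t) =
      mu (br (beta x) (beta y) z) (beta t)
      + eps (a + b) c *: mu (beta z) (br (alpha x) (alpha y) t)
}.

Definition is_regular alpha beta : Prop := bijective alpha /\ bijective beta.

Record is_rota_baxter0 V br mu alpha beta R : Prop := IsRotaBaxter0 {
  rb_even : even1 V R;
  rb_alpha : commuting R alpha;
  rb_beta : commuting R beta;
  rb_mu : forall a b x y, V a x -> V b y ->
    mu (R x) (R y) = R (mu (R x) y + mu x (R y));
  rb_br : forall a b c x y z, V a x -> V b y -> V c z ->
    br (R x) (R y) (R z) =
      R (br (R x) (R y) z + br (R x) y (R z) + br x (R y) (R z))
}.

(* [x, y, z]^C for x, y, z of degrees a, b, c; alphaV and betaV stand for the
   inverses of alpha and beta. *)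
Definition commutatorC br eps (alpha beta alphaV betaV : g -> g)
    (a b c : Gamma) (x y z : g) : g :=
  br x y z
  - eps b c *: br x (beta (alphaV z)) (alpha (betaV y))
  + eps a (b + c) *: br y (beta (alphaV z)) (alpha (betaV x)).

Definition inverse_of (f fV : g -> g) : Prop := cancel f fV /\ cancel fV f.

(* Since alpha and beta are required to be bijective, alphaV and betaV below
   exist and are unique. *)
Record is_3bihom_prelie V br eps alpha beta : Prop := Is3BiHomPreLie {
  pl_grading : is_grading V;
  pl_bichar : is_bicharacter eps;
  pl_trilinear : is_trilinear br;
  pl_even : even3 V br;
  pl_alpha_even : even1 V alpha;
  pl_beta_even : even1 V beta;
  pl_comm : commuting alpha beta;
  pl_alpha_bij : bijective alpha;
  pl_beta_bij : bijective beta;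
  pl_alpha_br : preserves3 V alpha br;
  pl_beta_br : preserves3 V beta br;
  pl_skew : forall a b c x y z, V a x -> V b y -> V c z ->
    br (beta x) (beta y) (alpha z) =
      - (eps a b *: br (beta y) (beta x) (alpha z));
  pl_jacobi : forall alphaV betaV : g -> g,
    inverse_of alpha alphaV -> inverse_of beta betaV ->
    let C := commutatorC br eps alpha beta alphaV betaV in
    forall a1 a2 a3 a4 a5 x1 x2 x3 x4 x5,
    V a1 x1 -> V a2 x2 -> V a3 x3 -> V a4 x4 -> V a5 x5 ->
    br (alpha (beta x4)) (alpha (beta x5)) (br x1 x2 x3) =
      br (C a4 a5 a1 (beta x4) (beta x5) x1) (beta x2) (beta x3)
      + eps (a4 + a5) a1 *:
        br (beta x1) (C a4 a5 a2 (beta x4) (beta x5) x2) (beta x3)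
      + eps (a4 + a5) (a1 + a2) *:
        br (beta x1) (beta x2) (br (alpha x4) (alpha x5) x3);
  pl_cyclic : forall alphaV betaV : g -> g,
    inverse_of alpha alphaV -> inverse_of beta betaV ->
    let C := commutatorC br eps alpha beta alphaV betaV in
    forall a1 a2 a3 a4 a5 x1 x2 x3 x4 x5,
    V a1 x1 -> V a2 x2 -> V a3 x3 -> V a4 x4 -> V a5 x5 ->
    br (C a4 a5 a1 (beta x4) (beta x5) x1) (beta x2) (beta x3) =
      eps a4 (a1 + a5) *:
        br (alpha (beta x5)) (beta x1) (br (alpha x4) x2 x3)
      + eps (a4 + a5) a1 *:
        br (beta x1) (alpha (beta x4)) (br (alpha x5) x2 x3)
      + br (alpha (beta x4)) (alpha (beta x5)) (br x1 x2 x3)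
}.

Record is_bihom_dendriform V prec succ eps alpha beta : Prop :=
  IsBiHomDendriform {
  bd_grading : is_grading V;
  bd_bichar : is_bicharacter eps;
  bd_prec_bilinear : is_bilinear prec;
  bd_succ_bilinear : is_bilinear succ;
  bd_prec_even : even2 V prec;
  bd_succ_even : even2 V succ;
  bd_alpha_even : even1 V alpha;
  bd_beta_even : even1 V beta;
  bd_comm : commuting alpha beta;
  bd_alpha_prec : preserves2 V alpha prec;
  bd_alpha_succ : preserves2 V alpha succ;
  bd_beta_prec : preserves2 V beta prec;
  bd_beta_succ : preserves2 V beta succ;
  bd_prec_prec : forall a b c x y z, V a x -> V b y -> V c z ->
    prec (prec x y) (beta z) = prec (alpha x) (prec y z + succ y z);
  bd_succ_prec : forall a b c x y z, V a x -> V b y -> V c z ->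
    prec (succ x y) (beta z) = succ (alpha x) (prec y z);
  bd_succ_succ : forall a b c x y z, V a x -> V b y -> V c z ->
    succ (alpha x) (succ y z) = succ (prec x y + succ x y) (beta z)
}.

Record is_nc_3bihom_prepoisson V br prec succ eps alpha beta : Prop :=
  IsNC3BiHomPrePoisson {
  pp_prelie : is_3bihom_prelie V br eps alpha beta;
  pp_dendriform : is_bihom_dendriform V prec succ eps alpha beta;
  pp_P1 : forall a b c d x y z t, V a x -> V b y -> V c z -> V d t ->
    br (alpha (beta (beta x))) (alpha (beta (beta y))) (prec z (alpha t))
    - prec (br (beta (beta x)) (beta (beta y)) z) (alpha (beta t)) =
      eps (a + b) c *:
        prec (beta z)
          (br (alpha (beta x)) (alpha (beta y)) (alpha t)
           - eps b d *: br (alpha (beta x)) (beta t) (alpha (alpha y))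
           + eps a (b + d) *: br (alpha (beta y)) (beta t) (alpha (alpha x)));
  pp_P2 : forall a b c d x y z t, V a x -> V b y -> V c z -> V d t ->
    br (alpha (beta x)) (alpha (alpha (beta y))) (succ (alpha z) t)
    - eps (a + b) c *:
        succ (alpha (beta z)) (br (alpha x) (alpha (alpha y)) t) =
      succ
        (br (beta x) (alpha (beta y)) (alpha z)
         - eps b c *: br (beta x) (beta z) (alpha (alpha y))
         + eps a (b + c) *: br (alpha (beta y)) (beta z) (alpha x))
        (beta t);
  pp_P3 : forall a b c d x y z t, V a x -> V b y -> V c z -> V d t ->
    br (alpha (beta x)) (beta (prec y z)) (alpha (alpha (beta t)))
    + br (alpha (beta x)) (beta (succ y z)) (alpha (alpha (beta t))) =
      eps a b *:
        succ (alpha (beta y)) (br (alpha x) (beta z) (alpha (alpha t)))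
      + eps c d *:
        prec (br (beta x) (beta y) (alpha (beta t))) (alpha (beta z))
}.

End ColorAlgebras.

(* Main.v *)
(** The twists are removed by setting L(x, y, z) = {alpha^-1 x, alpha^-1 y, beta^-1 z}
    and m(x, y) = mu(alpha^-1 x, beta^-1 y): L is a 3-Lie color bracket acting by
    derivations on m, and alpha, beta are endomorphisms of both.  Each 3-bracket
    identity then becomes untwisted; the combination [x, y, z]^C, after applying
    R, collapses to L(R x, R y, R z) by the Rota-Baxter relation, and what
    remains follows from the derivation property of L on itself or on m by color
    skew-symmetry. *)

Require Import Defs.
From HB Require Import structures.
From mathcomp Require Import all_boot all_order all_algebra.
From mathcomp Require Import ring.

Set Implicit Arguments.
Unset Strict Implicit.
Unset Printing Implicit Defensive.

Import GRing.Theory.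
Local Open Scope ring_scope.

(** The pre-Lie axioms quantify over all inverses of the twists; this exchanges any of them for the
    one obtained from bijectivity. *)
Lemma inverseE {K : closedFieldType} {g : lmodType K} (f fV fV' : g -> g) :
  inverse_of f fV -> cancel f fV' -> fV =1 fV'.
Proof. by move=> [_ fVK] fK' x; rewrite -{2}(fVK x) fK'. Qed.

(** * Linear functions given without a bundled structure *)

Section LinearFunctions.

Context {K : closedFieldType} {g : lmodType K} (f : g -> g) (lf : linear f).

(** The slots of [br] and [mu] are linear only by hypothesis; bundling gives access to the library
    lemmas on linear maps. *)
Let F : {linear g -> g} := HB.pack f (GRing.isLinear.Build K g g *:%R f lf).

Lemma lin0 : f 0 = 0. Proof. exact: (linear0 F). Qed.
Lemma linD x y : f (x + y) = f x + f y. Proof. exact: (linearD F). Qed.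
Lemma linN x : f (- x) = - f x. Proof. exact: (linearN F). Qed.
Lemma linZ k x : f (k *: x) = k *: f x. Proof. exact: (linearZZ F). Qed.

End LinearFunctions.

(** * Internal gradings and reduction to homogeneous elements *)

Section Homogeneous.

Context {K : closedFieldType} {Gamma : zmodType} {g : lmodType K}.
Context (V : Gamma -> g -> Prop) (gV : is_grading V).

Lemma homogeneous_ind (P : g -> Prop) :
  P 0 -> (forall x y, P x -> P y -> P (x + y)) ->
  (forall a x, V a x -> P x) -> forall x, P x.
Proof.
move=> P0 PD PV x; have [s [f [_ Vf ->]]] := grading_span gV x.
by apply: big_ind => // a _; apply: PV (Vf a).
Qed.

Lemma gradingN a x : V a x -> V a (- x).
Proof.
move=> Vx; rewrite -scaleN1r -[_ *: _]addr0.
exact: (grading_linear gV) _ _ _ _ Vx (grading0 gV a).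
Qed.

Lemma grading_sub a x y : V a x -> V a y -> V a (x - y).
Proof.
move=> Vx Vy; rewrite -[x]scale1r.
exact: (grading_linear gV) _ _ _ _ Vx (gradingN Vy).
Qed.

(** Padding the support with a zero component at [a] lets [grading_direct] be applied at that
    degree. *)
Lemma homogeneous_decomposition a x :
  exists (s : seq Gamma) (f : Gamma -> g),
    [/\ uniq s, a \in s, forall b, V b (f b) & x = \sum_(b <- s) f b].
Proof.
have [s [f [us Vf ->]]] := grading_span gV x.
have [sa | sNa] := boolP (a \in s); first by exists s, f.
exists (a :: s), (fun b => if b == a then 0 else f b); split=> //=.
- by rewrite sNa.
- by rewrite mem_head.
- by move=> b; case: eqP => // _; apply: grading0.
rewrite big_cons eqxx add0r; apply: eq_big_seq => b sb.
by case: eqP => // ba; rewrite -ba sb in sNa.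
Qed.

(** If [fV x] has components [h b], then [x] is the sum of the homogeneous [f (h b)]. Directness
    leaves only [f (h a) = x], and injectivity gives [fV x = h a]. *)
Lemma even_inverse (f : {linear g -> g}) (fV : g -> g) :
  even1 V f -> inverse_of f fV -> even1 V fV.
Proof.
move=> ef [fK fVK] a x Vx.
have [s [h [us sa Vh fVx]]] := homogeneous_decomposition a (fV x).
pose k b := f (h b) - (if b == a then x else 0).
have Vk b : V b (k b).
  apply: grading_sub; first exact: ef.
  by case: eqP => [->|_] //; apply: (grading0 gV).
have k0 : \sum_(b <- s) k b = 0.
  rewrite sumrB -linear_sum -fVx fVK (bigD1_seq a) //= eqxx.
  rewrite big1 ?addr0 ?subrr //.
  by move=> b /negPf->.
suff -> : fV x = h a by apply: Vh.
apply: (can_inj fK); rewrite fVK; apply/esym/eqP; rewrite -subr_eq0.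
by have := grading_direct gV us Vk k0 sa; rewrite /k eqxx => ->.
Qed.

(** Both sides are additive in each argument, so homogeneous arguments suffice; the total form
    rewrites without degree side conditions. *)
Lemma preserves2_total (f : {linear g -> g}) mu : is_bilinear mu ->
  preserves2 V f mu -> forall x y, f (mu x y) = mu (f x) (f y).
Proof.
move=> [lr ll] fmu x y; elim/homogeneous_ind: x => [|x x' IH IH'|a x Vx].
- by rewrite linear0 !(lin0 (ll _)) linear0.
- by rewrite linearD !(linD (ll _)) linearD IH IH'.
elim/homogeneous_ind: y => [|y y' IH IH'|b y Vy]; last exact: fmu Vx Vy.
- by rewrite linear0 !(lin0 (lr _)) linear0.
- by rewrite linearD !(linD (lr _)) linearD IH IH'.
Qed.

Lemma preserves3_total (f : {linear g -> g}) br : is_trilinear br ->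
  preserves3 V f br -> forall x y z, f (br x y z) = br (f x) (f y) (f z).
Proof.
move=> [l3 l2 l1] fbr x y z; elim/homogeneous_ind: x => [|x x' IH IH'|a x Vx].
- by rewrite linear0 !(lin0 (l1 _ _)) linear0.
- by rewrite linearD !(linD (l1 _ _)) linearD IH IH'.
elim/homogeneous_ind: y => [|y y' IH IH'|b y Vy].
- by rewrite linear0 !(lin0 (l2 _ _)) linear0.
- by rewrite linearD !(linD (l2 _ _)) linearD IH IH'.
elim/homogeneous_ind: z => [|z z' IH IH'|c z Vz]; last exact: fbr Vx Vy Vz.
- by rewrite linear0 !(lin0 (l3 _ _)) linear0.
- by rewrite linearD !(linD (l3 _ _)) linearD IH IH'.
Qed.

End Homogeneous.

(** * Untwisted identities for a 3-Lie color bracket and a product *)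

Section ColorPoisson.

Context {K : closedFieldType} {Gamma : zmodType} {g : lmodType K}.
Context (V : Gamma -> g -> Prop) (eps : Gamma -> Gamma -> K).
Context (beps : is_bicharacter eps).

Lemma bicharV a b : eps a b = (eps b a)^-1.
Proof.
apply: (mulIf (bichar_neq0 beps b a)).
by rewrite mulVf ?(bichar_neq0 beps) // (bichar_skew beps).
Qed.

Context (L : g -> g -> g -> g) (Ltri : is_trilinear L) (Leven : even3 V L).
Context (Lskew12 : forall a b c x y z, V a x -> V b y -> V c z ->
  L x y z = - (eps a b *: L y x z)).
Context (Lskew23 : forall a b c x y z, V a x -> V b y -> V c z ->
  L x y z = - (eps b c *: L x z y)).

Lemma bracket_rot a b c x y z : V a x -> V b y -> V c z ->
  L x y z = eps a (b + c) *: L y z x.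
Proof.
move=> Vx Vy Vz; rewrite (Lskew12 Vx Vy Vz) (Lskew23 Vy Vx Vz).
by rewrite scalerN opprK scalerA (bicharDr beps).
Qed.

Lemma bracket_rotV a b c x y z : V a x -> V b y -> V c z ->
  L x y z = eps (a + b) c *: L z x y.
Proof.
move=> Vx Vy Vz; rewrite (Lskew23 Vx Vy Vz) (Lskew12 Vx Vz Vy).
by rewrite scalerN opprK scalerA (bicharDl beps) mulrC.
Qed.

Context (Ljac : forall a b c d e x y z u v,
  V a x -> V b y -> V c z -> V d u -> V e v ->
  L x y (L z u v) = eps (a + b + c) (d + e) *: L u v (L x y z)
    - (eps (a + b) (c + e) * eps d e) *: L z v (L x y u)
    + eps (a + b) (c + d) *: L z u (L x y v)).

(** The Jacobi identity with the inner bracket brought back to its place: a rotation in the first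
    term, a swap of the last two slots in the second. *)
Lemma bracket_derivation a b c d e x y z u v :
  V a x -> V b y -> V c z -> V d u -> V e v ->
  L x y (L z u v) = L (L x y z) u v + eps (a + b) c *: L z (L x y u) v
                    + eps (a + b) (c + d) *: L z u (L x y v).
Proof.
move=> Vx Vy Vz Vu Vv; rewrite (Ljac Vx Vy Vz Vu Vv).
rewrite (bracket_rot (Leven Vx Vy Vz) Vu Vv).
rewrite (Lskew23 Vz (Leven Vx Vy Vu) Vv) scalerN scalerA.
by congr (_ - _ *: _ + _); rewrite !(bicharDl beps, bicharDr beps); ring.
Qed.

(** Untwisted form of the axiom [pl_cyclic]. Rotate to [L u v (L x y z)], let [L u v] act as a
    derivation, then rotate every inner and outer bracket back. *)
Lemma bracket_leftE a b c d e x y z u v :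
  V a x -> V b y -> V c z -> V d u -> V e v ->
  L (L x y z) u v = eps a (c + b) *: L y z (L x u v)
    + eps (a + b) c *: L z x (L y u v) + L x y (L z u v).
Proof.
move=> Vx Vy Vz Vu Vv; have [lz ly lx] := Ltri.
rewrite (bracket_rot (Leven Vx Vy Vz) Vu Vv).
rewrite (bracket_derivation Vu Vv Vx Vy Vz).
rewrite (bracket_rotV Vu Vv Vx) (bracket_rotV Vu Vv Vy) (bracket_rotV Vu Vv Vz).
rewrite (linZ (lx _ _)) (linZ (ly _ _)) (linZ (lz _ _)).
rewrite (bracket_rot (Leven Vx Vu Vv) Vy Vz).
rewrite (bracket_rotV Vx (Leven Vy Vu Vv) Vz).
rewrite !scalerDr !scalerA -[X in _ = _ + X]scale1r.
rewrite !(bicharDl beps, bicharDr beps).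
(* Orienting every mixed factor the same way reduces the coefficients to an identity of
   fractions. *)
rewrite (bicharV d a) (bicharV d b) (bicharV d c).
rewrite (bicharV e a) (bicharV e b) (bicharV e c).
by congr (_ *: _ + _ *: _ + _ *: _); field; rewrite !(bichar_neq0 beps).
Qed.

Context (m : g -> g -> g) (mbil : is_bilinear m) (meven : even2 V m).
Context (Lm : forall a b c d x y z t, V a x -> V b y -> V c z -> V d t ->
  L x y (m z t) = m (L x y z) t + eps (a + b) c *: m z (L x y t)).

(** Untwisted form of (P3): swap the product into the last slot, apply the Leibniz rule, and swap
    back. *)
Lemma leibniz_middle a b c d x y z t : V a x -> V b y -> V c z -> V d t ->
  L x (m y z) t = eps a b *: m y (L x z t) + eps c d *: m (L x y t) z.
Proof.
move=> Vx Vy Vz Vt; have [lr ll] := mbil.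
rewrite (Lskew23 Vx (meven Vy Vz) Vt) (Lm Vx Vt Vy Vz).
rewrite (Lskew23 Vx Vt Vy) (Lskew23 Vx Vt Vz).
rewrite (linN (ll _)) (linZ (ll _)) (linN (lr _)) (linZ (lr _)).
rewrite scalerDr !scalerN opprD !opprK !scalerA addrC.
rewrite !(bicharDl beps, bicharDr beps) (bicharV d b) (bicharV d c).
by congr (_ *: _ + _ *: _); field; rewrite !(bichar_neq0 beps).
Qed.

Context (R : {linear g -> g}) (Reven : even1 V R).
Context (RL : forall a b c x y z, V a x -> V b y -> V c z ->
  L (R x) (R y) (R z) =
    R (L (R x) (R y) z + L (R x) y (R z) + L x (R y) (R z))).

(** Skew-symmetry turns the two signed terms into [L (R x) y (R z)] and [L x (R y) (R z)],
    completing the Rota-Baxter sum. *)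
Lemma rota_baxter_commutator a b c x y z : V a x -> V b y -> V c z ->
  R (L (R x) (R y) z - eps b c *: L (R x) (R z) y
     + eps a (b + c) *: L (R y) (R z) x) = L (R x) (R y) (R z).
Proof.
move=> Vx Vy Vz; rewrite (RL Vx Vy Vz).
rewrite (Lskew23 (Reven Vx) Vy (Reven Vz)).
by rewrite (bracket_rot Vx (Reven Vy) (Reven Vz)).
Qed.

End ColorPoisson.

Ltac homogeneous :=
  repeat match goal with
  | H : even1 ?V ?f |- ?V _ (?f _) => apply: H
  | H : even2 ?V ?f |- ?V _ (?f _ _) => apply: H
  | H : even3 ?V ?f |- ?V _ (?f _ _ _) => apply: H
  end; try assumption.

(** * Untwisting, then the pre-Poisson axioms one by one *)

Theorem corollary4p12 (K : closedFieldType) (charK0 : [pchar K] =i pred0)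
    (Gamma : zmodType) (g : lmodType K) (V : Gamma -> g -> Prop)
    (br : g -> g -> g -> g) (mu : g -> g -> g) (eps : Gamma -> Gamma -> K)
    (alpha beta R : {linear g -> g})
    (hP : is_nc_3bihom_poisson V br mu eps alpha beta)
    (hmult : is_multiplicative V br alpha beta)
    (hreg : is_regular alpha beta)
    (hR : is_rota_baxter0 V br mu alpha beta R) :
  is_nc_3bihom_prepoisson V
    (fun x y z => br (R x) (R y) z)
    (fun x y => mu x (R y))
    (fun x y => mu (R x) y)
    eps alpha beta.
Proof.
have [[aV aK aVK] [bV bK bVK]] := hreg.
have [hmu hL leib] := hP.
have [gV beps mubil mueven aE bE ab amu bmu assoc] := hmu.
have [_ _ brtri breven _ _ skew12 skew23 jac] := hL.
have [_ abr bbr] := hmult.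
have [RE Ra Rb Rmu Rbr] := hR.
have {}abr := preserves3_total gV brtri abr.
have {}bbr := preserves3_total gV brtri bbr.
have {}amu := preserves2_total gV mubil amu.
have {}bmu := preserves2_total gV mubil bmu.
have aVE : even1 V aV by apply: (even_inverse gV aE); split.
have bVE : even1 V bV by apply: (even_inverse gV bE); split.
pose L x y z := br (aV x) (aV y) (bV z).
pose m x y := mu (aV x) (bV y).
have brE x y z : br x y z = L (alpha x) (alpha y) (beta z) by rewrite /L !aK bK.
have muE x y : mu x y = m (alpha x) (beta y) by rewrite /m aK bK.
have aR x : alpha (R x) = R (alpha x) by [].
have bR x : beta (R x) = R (beta x) by [].
have aVb x : aV (beta x) = beta (aV x).
  by apply: (can_inj aK); rewrite aVK ab aVK.
have abV x : alpha (bV x) = bV (alpha x).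
  by apply: (can_inj bK); rewrite bVK -ab bVK.
have aVR x : aV (R x) = R (aV x).
  by apply: (can_inj aK); rewrite aVK aR aVK.
have bVR x : bV (R x) = R (bV x).
  by apply: (can_inj bK); rewrite bVK bR bVK.
have aL x y z : alpha (L x y z) = L (alpha x) (alpha y) (alpha z).
  by rewrite /L abr !aVK !aK abV.
have bL x y z : beta (L x y z) = L (beta x) (beta y) (beta z).
  by rewrite /L bbr !aVb bVK bK.
have am x y : alpha (m x y) = m (alpha x) (alpha y).
  by rewrite /m amu aVK aK abV.
have bm x y : beta (m x y) = m (beta x) (beta y).
  by rewrite /m bmu aVb bVK bK.
have aVlin : linear aV.
  by move=> k x y; apply: (can_inj aK); rewrite linearP !aVK.
have bVlin : linear bV.
  by move=> k x y; apply: (can_inj bK); rewrite linearP !bVK.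
have [br3 br2 br1] := brtri; have [mur mul] := mubil.
have Ltri : is_trilinear L.
  split=> [x y|x z|y z] k u v; rewrite /L.
  - by rewrite bVlin br3.
  - by rewrite aVlin br2.
  by rewrite aVlin br1.
have mbil : is_bilinear m.
  by split=> [x|y] k u v; rewrite /m (bVlin, aVlin) (mur, mul).
have LE : even3 V L by move=> a b c x y z *; apply: breven; auto.
have mE : even2 V m by move=> a b x y *; apply: mueven; auto.
have L12 a b c x y z : V a x -> V b y -> V c z ->
  L x y z = - (eps a b *: L y x z).
  move=> Vx Vy Vz.
  (* The arguments absorb the twists of the axiom, leaving exactly the entries in the definition of
     [L]. *)
  have := skew12 a b c (bV (aV x)) (bV (aV y)) (aV (bV z)).
  by rewrite !bVK aVK => H; apply: H; auto 10.
have L23 a b c x y z : V a x -> V b y -> V c z ->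
  L x y z = - (eps b c *: L x z y).
  move=> Vx Vy Vz.
  have := skew23 a b c (aV (bV x)) (aV (bV y)) (aV (bV z)).
  by rewrite !brE !ab !aVK !bVK => H; apply: H; auto 10.
have Ljac a b c d e x y z u v :
  V a x -> V b y -> V c z -> V d u -> V e v ->
  L x y (L z u v) = eps (a + b + c) (d + e) *: L u v (L x y z)
    - (eps (a + b) (c + e) * eps d e) *: L z v (L x y u)
    + eps (a + b) (c + d) *: L z u (L x y v).
  (* Written with [L], every variable of the Jacobi identity carries alpha beta^2, in each term; [w]
     cancels it. *)
  move=> Vx Vy Vz Vu Vv; pose w p := aV (bV (bV p)).
  have := jac a b c d e (w x) (w y) (w z) (w u) (w v).
  by rewrite /w !brE !bL !ab !aVK !bVK => H; apply: H; auto 10.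
have Lm a b c d x y z t : V a x -> V b y -> V c z -> V d t ->
  L x y (m z t) = m (L x y z) t + eps (a + b) c *: m z (L x y t).
  move=> Vx Vy Vz Vt.
  (* In all terms of the Leibniz rule [x] and [y] carry alpha^2 beta, [z] carries alpha beta and [t]
     carries beta^2. *)
  pose w p := aV (aV (bV p)).
  have := leib a b c d (w x) (w y) (aV (bV z)) (bV (bV t)).
  by rewrite /w !brE !muE !(aL, bL, am, bm) !ab !aVK !bVK => H; apply: H; auto 10.
have RL a b c x y z : V a x -> V b y -> V c z ->
  L (R x) (R y) (R z) =
    R (L (R x) (R y) z + L (R x) y (R z) + L x (R y) (R z)).
  by move=> *; rewrite /L !aVR !bVR; apply: Rbr; eauto.
clearbody L m.
have Lder := bracket_derivation beps LE L12 L23 Ljac.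
have Lleft := bracket_leftE beps Ltri LE L12 L23 Ljac.
have Lmid := leibniz_middle beps L23 mbil mE Lm.
have RD := rota_baxter_commutator beps L12 L23 RE RL.
have aD x y := linearD alpha x y; have aN x := linearN alpha x.
have aZ k x : alpha (k *: x) = k *: alpha x by rewrite linearZZ.
have bD x y := linearD beta x y; have bN x := linearN beta x.
have bZ k x : beta (k *: x) = k *: beta x by rewrite linearZZ.
(* Normal form: twists move inside [R], [L] and [m] down to the variables, with [beta] outside
   [alpha]. *)
have push := (ab, aR, bR, aL, bL, am, bm, aD, aN, aZ, bD, bN, bZ).
have trilin : is_trilinear (fun x y z => br (R x) (R y) z).
  by split=> [x y|x z|y z] k u v; rewrite ?linearP ?(br3, br2, br1).
split; first split=> //.
- by move=> a b c x y z *; apply: breven; auto.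
- by exists aV.
- by exists bV.
- by move=> a b c x y z *; rewrite abr !aR.
- by move=> a b c x y z *; rewrite bbr !bR.
- by move=> a b c x y z *; rewrite -!bR; apply: skew12; eauto.
- move=> alphaV betaV hA hB C a1 a2 a3 a4 a5 x1 x2 x3 x4 x5.
  move=> V1 V2 V3 V4 V5.
  rewrite /C /commutatorC !(inverseE hA aK) !(inverseE hB bK).
  (* All inverses vanish: [bV] only meets [beta x4] or [beta x5], and [aV] meets the [alpha]
     introduced by [brE]. *)
  rewrite !brE !push !aVK !bK.
  rewrite (RD a4 a5 a1); try homogeneous.
  rewrite (RD a4 a5 a2); try homogeneous.
  by apply: (Lder a4 a5 a1 a2 a3); homogeneous.
- move=> alphaV betaV hA hB C a1 a2 a3 a4 a5 x1 x2 x3 x4 x5.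
  move=> V1 V2 V3 V4 V5.
  rewrite /C /commutatorC !(inverseE hA aK) !(inverseE hB bK).
  rewrite !brE !push !aVK !bK.
  rewrite (RD a4 a5 a1); try homogeneous.
  by apply: (Lleft a4 a5 a1 a2 a3); homogeneous.
- split=> //.
  + by split=> [x|y] k u v; rewrite ?linearP (mur, mul).
  + by split=> [x|y] k u v; rewrite ?linearP (mur, mul).
  + by move=> a b x y *; apply: mueven; auto.
  + by move=> a b x y *; apply: mueven; auto.
  + by move=> a b x y *; rewrite amu aR.
  + by move=> a b x y *; rewrite amu aR.
  + by move=> a b x y *; rewrite bmu bR.
  + by move=> a b x y *; rewrite bmu bR.
  (* Since [R] of the total product of [y] and [z] is [mu (R y) (R z)], the axiom is
     BiHom-associativity at [x], [R y], [R z]. *)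
  + move=> a b c x y z Vx Vy Vz; rewrite [mu y _ + _]addrC -(Rmu b c) //.
    by rewrite -bR (assoc a b c); auto.
  + by move=> a b c x y z Vx Vy Vz; rewrite -bR -aR (assoc a b c); auto.
  + move=> a b c x y z Vx Vy Vz; rewrite [mu x _ + _]addrC -(Rmu a b) //.
    by rewrite -aR (assoc a b c); auto.
- move=> a b c d x y z t Vx Vy Vz Vt; rewrite !brE !muE !push.
  (* The parenthesis of (P1) lies under [R], so it collapses to one bracket and the Leibniz rule
     remains. *)
  rewrite (RD a b d); try homogeneous.
  rewrite (Lm a b c d); try homogeneous.
  by rewrite addrAC subrr add0r.
- move=> a b c d x y z t Vx Vy Vz Vt; rewrite !brE !muE !push.
  rewrite (RD a b c); try homogeneous.
  by rewrite (Lm a b c d) ?addrK; homogeneous.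
- move=> a b c d x y z t Vx Vy Vz Vt.
  (* The two brackets merge into one whose middle slot is [R] of the total product of [y] and [z],
     hence [mu (R y) (R z)] up to [beta]. *)
  rewrite -(linD (br2 _ _)) -!linearD [mu y _ + _]addrC -(bR (mu _ _ + _)).
  rewrite -(Rmu b c) // !brE !muE !push.
  by apply: (Lmid a b c d); homogeneous.
Qed.
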